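(* Let $(V,h)$ be an oriented seven-dimensional real vector space with a metric of signature $(4,3)$, and let $(\Sigma,\gamma_l,\mathscr{B})$ be an irreducible paired Clifford module, $l\in\{-1,+1\}$. An exterior form $\alpha\in\Lambda^<V^*=\bigoplus_{k=0}^3\Lambda^kV^*$ is the square of an isotropic spinor if and only if $\alpha=\vartheta\wedge\theta\wedge\eta\in\Lambda^3V^*$ for some $\vartheta,\theta,\eta\in V^*$ that are isotropic and (mutually) orthogonal.
   Context: Signature $(4,3)$ means four positive and three negative directions. $(V^*,h^* )$ is the dual quadratic space and $\mathrm{Cl}(4,3)=\mathrm{Cl}(V^*,h^* )$ its Clifford algebra with convention $\theta^2=h^*(\theta,\theta)$. It is identified with $(\Lambda V^*,\diamond)$, where the geometric product $\diamond$ is the associative bilinear product determined by $\theta\diamond\alpha=\theta\wedge\alpha+\iota_{\theta^\sharp}\alpha$ for $\theta\in V^*$, $\alpha\in\Lambda V^*$. On $\Lambda^aV^*$: $\pi(\alpha)=(-1)^a\alpha$, $\tau(\alpha)=(-1)^{\binom a2}\alpha$. The volume form $\nu$ is central with $\nu\diamond\nu=1$. An irreducible paired Clifford module $(\Sigma,\gamma_l,\mathscr{B})$: $\Sigma$ is an eight-dimensional real vector space, $\gamma_l:\mathrm{Cl}(4,3)\to\mathrm{End}(\Sigma)$ is the irreducible representation with $\gamma_l(\nu)=l\,\mathrm{Id}$, and $\mathscr{B}$ is an admissible pairing, i.e. a non-degenerate symmetric bilinear form with $\mathscr{B}(\gamma_l(x)\varepsilon_1,\varepsilon_2)=\mathscr{B}(\varepsilon_1,\gamma_l((\pi\circ\tau)(x))\varepsilon_2)$.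 A spinor $\varepsilon\in\Sigma$ is isotropic if $\mathscr{B}(\varepsilon,\varepsilon)=0$. The map $\Psi_l^<:\Lambda^<V^*\to\mathrm{End}(\Sigma)$, $\Psi_l^<(\alpha)=\gamma_l(\mathcal{P}_l(\alpha))$ with $\mathcal{P}_l(\alpha)=\frac12(\alpha+l\,\nu\diamond\alpha)$, is a linear isomorphism. For $\mu\in\{-1,+1\}$ set $\mathcal{E}_l^\mu(\varepsilon)=(\Psi_l^<)^{-1}(\mu\,\varepsilon\otimes\varepsilon^* )$, $\varepsilon^*=\mathscr{B}(-,\varepsilon)$. An exterior form $\alpha\in\Lambda^<V^*$ is the square of $\varepsilon$ if $\alpha=\mathcal{E}_l^\mu(\varepsilon)$ for some $\mu\in\{-1,+1\}$. *)

(* Defs.v *)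
From HB Require Import structures.
From mathcomp Require Import all_boot all_order all_algebra.
From mathcomp Require Import reals.

Set Implicit Arguments.
Unset Strict Implicit.
Unset Printing Implicit Defensive.

Import Order.TTheory GRing.Theory Num.Theory.

Local Open Scope ring_scope.

Section Exterior.

Variables (K : fieldType) (W : vectType K).

Local Notation n := (\dim {:W}).
Local Notation b := (vbasis {:W}).

(* The exterior algebra of W in coordinates: x I is the coefficient of the    *)
(* monomial b_(i1) /\ ... /\ b_(ik), for I = {i1 < ... < ik} and b the basis  *)
(* vbasis {:W} of W.                                                          *)
Definition exterior := {ffun {set 'I_n} -> K^o}.

Definition ext_const (c : K) : exterior := [ffun I => c *+ (I == set0)].

Definition ext_vec (w : W) : exterior :=
  [ffun I => \sum_(i < n) coord b i w *+ (I == [set i])].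

Definition ext_mono (I : {set 'I_n}) : exterior := [ffun J => (J == I)%:R].

Definition below (i : 'I_n) (J : {set 'I_n}) : nat := #|[set j in J | (j < i)%N]|.

Definition inversions (I J : {set 'I_n}) : nat := (\sum_(i in I) below i J)%N.

Definition wedge (x y : exterior) : exterior :=
  [ffun L : {set 'I_n} => \sum_(I : {set 'I_n} | I \subset L)
    (-1) ^+ inversions I (L :\: I) * (x I * y (L :\: I))].

(* Contraction with a linear form phi on W: the antiderivation of wedge that  *)
(* maps ext_vec w to phi w.                                                   *)
Definition interior (phi : W -> K) (x : exterior) : exterior :=
  [ffun J : {set 'I_n} => \sum_(i < n | i \notin J)
    (-1) ^+ below i J * (phi b`_i * x (i |: J))].

Definition ext_deg (k : nat) : {vspace exterior} :=
  <<[seq ext_mono A | A <- enum [set A : {set 'I_n} | #|A| == k]]>>%VS.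

Definition ext_lt (k : nat) : {vspace exterior} :=
  (\sum_(i < k) ext_deg i)%VS.

Definition grade_involution (x : exterior) : exterior :=
  [ffun I : {set 'I_n} => (-1) ^+ #|I| * x I].

Definition reversion (x : exterior) : exterior :=
  [ffun I : {set 'I_n} => (-1) ^+ 'C(#|I|, 2) * x I].

End Exterior.

Section ExteriorTheory.
Variables (K : fieldType) (W : vectType K).
Local Notation n := (\dim {:W}).
Local Notation b := (vbasis {:W}).
Implicit Types (w v : W) (x y : exterior W) (I J L : {set 'I_n}).

Lemma belowU1 k l J : l \notin J -> below k (l |: J) = ((l < k) + below k J)%N.
Proof.
move=> lJ; rewrite /below; case: ltnP => lk.
  rewrite (_ : [set _ in _ | _] = l |: [set j in J | (j < k)%N]).
    by rewrite cardsU1 !inE (negbTE lJ).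
  by apply/setP=> j; rewrite !inE; case: eqP => // ->; rewrite lk.
congr #|pred_of_set _|; apply/setP=> j; rewrite !inE.
by case: eqP => // ->; rewrite ltnNge lk (negbTE lJ).
Qed.

Lemma belowD1 k l J : l \in J -> below k J = ((l < k) + below k (J :\ l))%N.
Proof. by move=> lJ; rewrite -{1}(setD1K lJ) belowU1 // !inE eqxx. Qed.

Lemma inversionsUl I J L : [disjoint I & J] ->
  inversions (I :|: J) L = (inversions I L + inversions J L)%N.
Proof. by move=> IJ; rewrite /inversions (eq_bigl [predU I & J]) ?bigU //= => i; rewrite inE. Qed.

Lemma inversionsUr I J L : [disjoint J & L] ->
  inversions I (J :|: L) = (inversions I J + inversions I L)%N.
Proof.
move=> JL; rewrite /inversions -big_split; apply: eq_bigr => i _ /=.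
rewrite -cardsUI (_ : _ :&: _ = set0) ?cards0 ?addn0.
  by congr #|pred_of_set _|; apply/setP=> j; rewrite !inE andb_orl.
apply/setP=> j; rewrite !inE; case: (boolP (j \in J)) => //= jJ.
by rewrite (disjointFr JL jJ) andbF.
Qed.

Lemma wedgeA : associative (@wedge K W).
Proof.
move=> x y z; apply/ffunP=> L; rewrite ffunE [RHS]ffunE.
under eq_bigr do rewrite ffunE !mulr_sumr.
under [RHS]eq_bigr do rewrite ffunE mulr_suml mulr_sumr.
rewrite [RHS](exchange_big_dep (fun I => I \subset L)) /=; last first.
  by move=> M I ML /subset_trans; apply.
apply: eq_bigr => I IL.
rewrite [RHS](reindex_onto (fun J => I :|: J) (fun M => M :\: I)) /=; last first.
  by move=> M /andP[_ IM]; rewrite -{1}(setIidPr IM) setID.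
apply: eq_big => [J|J JLI].
  rewrite subUset IL subsetUl subsetD andbT /=; congr (_ && _).
  rewrite setDUl setDv set0U; apply/idP/eqP => [IJ|/setDidPl //].
  exact/setDidPl.
have IJ : [disjoint I & J].
  by move: JLI; rewrite subsetD disjoint_sym => /andP[].
have JI : (I :|: J) :\: I = J.
  by rewrite setDUl setDv set0U; apply/setDidPl; rewrite disjoint_sym.
rewrite JI -setDDl.
have LI : L :\: I = J :|: (L :\: I :\: J) by rewrite -{1}(setIidPr JLI) setID.
have dJ : [disjoint J & L :\: I :\: J] by rewrite disjoint_sym -setI_eq0 setIC setIDA setIC setDIl setDv setI0.
rewrite inversionsUl // [in inversions I (L :\: I)]LI inversionsUr // !exprD.
set s1 := (-1) ^+ _; set s2 := (-1) ^+ _; set s3 := (-1) ^+ _.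
rewrite !mulrA; congr (_ * _ * _).
by rewrite [LHS]mulrAC; congr (_ * _); rewrite -[LHS]mulrA mulrC.
Qed.

Lemma wedge1l x : wedge (ext_const W 1) x = x.
Proof.
apply/ffunP=> L; rewrite ffunE (bigD1 set0) ?sub0set //= big1 => [|I /andP[_ I0]].
  by rewrite ffunE eqxx setD0 /inversions big_set0 !mul1r addr0.
by rewrite ffunE (negbTE I0) mul0r mulr0.
Qed.

Lemma wedge1r x : wedge x (ext_const W 1) = x.
Proof.
apply/ffunP=> L; rewrite ffunE (bigD1 L) //= big1 => [|I /andP[IL IneL]].
  rewrite ffunE setDv eqxx mulr1 addr0 /inversions big1 ?mul1r // => i _.
  by apply: eq_card0 => j; rewrite !inE.
rewrite ffunE setD_eq0; case: (boolP (L \subset I)) => [LI|_]; last by rewrite !mulr0.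
by case/eqP: IneL; apply/eqP; rewrite eqEsubset IL.
Qed.

Lemma ext_coefCA (s c d z : K) m p : s = (-1) ^+ m ->
  s * (c * ((-1) ^+ p * (d * z))) = (-1) ^+ (m + p) * (c * d * z).
Proof. by move=> ->; rewrite exprD !mulrA [(-1) ^+ m * c * _]mulrAC. Qed.

Lemma sign_cancel (m p : nat) (z z' : K) : odd m = ~~ odd p -> z = z' ->
  (-1) ^+ m * z + (-1) ^+ p * z' = 0.
Proof.
move=> mp ->; rewrite -mulrDl -signr_odd -[(-1) ^+ p]signr_odd mp.
by case: odd; rewrite ?addNr ?subrr mul0r.
Qed.

Lemma interiorE phi x J : interior phi x J =
  \sum_(i < n | i \notin J) (-1) ^+ below i J * (phi b`_i * x (i |: J)).
Proof. by rewrite ffunE. Qed.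

Lemma wedge_vecE w y L : wedge (ext_vec w) y L =
  \sum_(i < n | i \in L) (-1) ^+ below i L * (coord b i w * y (L :\ i)).
Proof.
rewrite ffunE.
under eq_bigr => I _ do rewrite ffunE mulr_suml mulr_sumr.
rewrite exchange_big /= [RHS]big_mkcond; apply: eq_bigr => i _.
rewrite big_mkcond (bigD1 [set i]) //= big1 ?addr0 => [|I /negbTE ->]; last first.
  by rewrite mulr0n mul0r mulr0 if_same.
rewrite eqxx mulr1n sub1set; case: ifP => // iL.
congr ((-1) ^+ _ * _).
by rewrite /inversions big_set1 (belowD1 i iL) ltnn.
Qed.

Lemma wedge_vec_anti w v x :
  wedge (ext_vec w) (wedge (ext_vec v) x)
  + wedge (ext_vec v) (wedge (ext_vec w) x) = 0.
Proof.
apply/ffunP=> L; rewrite !ffunE -/(wedge _ _ _).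
have E (w1 w2 : W) : wedge (ext_vec w1) (wedge (ext_vec w2) x) L =
    \sum_(i < n) \sum_(j < n) if [&& i \in L, j \in L & j != i] then
    (-1) ^+ (below i L + below j (L :\ i)) *
      (coord b i w1 * coord b j w2 * x (L :\ i :\ j)) else 0.
  rewrite wedge_vecE big_mkcond; apply: eq_bigr => i _; case: ifP => iL /=.
    rewrite wedge_vecE mulr_sumr mulr_sumr big_mkcond; apply: eq_bigr => j _.
    by rewrite !inE andbC; case: ifP => // _; exact: ext_coefCA.
  by rewrite big1.
have := E w v; have := E v w; rewrite !ffunE => -> ->.
rewrite [X in _ + X]exchange_big -big_split big1 //= => i _.
rewrite -big_split big1 //= => j _.
rewrite [i == j]eq_sym; case: (i =P j) => [->|/eqP ij]; first by rewrite eqxx !andbF addr0.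
rewrite eq_sym ij !andbT andbC; case: ifP => [/andP[jL iL]|_]; last by rewrite addr0.
rewrite (belowD1 i jL) (belowD1 j iL).
have -> : L :\ j :\ i = L :\ i :\ j by apply/setP=> k; rewrite !inE andbCA.
apply: sign_cancel; last by rewrite [coord b i w * _]mulrC.
case: ltngtP => [||/ord_inj e]; last by rewrite e eqxx in ij.
all: by move=> _; rewrite !oddD; do 2!case: (odd (below _ _)).
Qed.

Lemma interior_anti phi psi x :
  interior phi (interior psi x) + interior psi (interior phi x) = 0.
Proof.
apply/ffunP=> L; rewrite [LHS]ffunE [RHS]ffunE.
have E (p q : W -> K) : interior p (interior q x) L =
    \sum_(i < n) \sum_(j < n) if [&& i \notin L, j \notin L & j != i] then
    (-1) ^+ (below i L + below j (i |: L)) *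
      (p b`_i * q b`_j * x (j |: (i |: L))) else 0.
  rewrite interiorE big_mkcond; apply: eq_bigr => i _; case: ifP => iL /=.
    rewrite interiorE mulr_sumr mulr_sumr big_mkcond; apply: eq_bigr => j _.
    by rewrite !inE negb_or andbC; case: ifP => // _; exact: ext_coefCA.
  by rewrite big1.
rewrite !E [X in _ + X]exchange_big -big_split big1 //= => i _.
rewrite -big_split big1 //= => j _.
rewrite [i == j]eq_sym; case: (i =P j) => [->|/eqP ij]; first by rewrite eqxx !andbF addr0.
rewrite eq_sym ij !andbT andbC; case: ifP => [/andP[jL iL]|_]; last by rewrite addr0.
rewrite (belowU1 i jL) (belowU1 j iL) setUCA.
apply: sign_cancel; last by rewrite [phi b`_i * _]mulrC.
case: ltngtP => [||/ord_inj e]; last by rewrite e eqxx in ij.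
all: by move=> _; rewrite !oddD; do 2!case: (odd (below _ _)).
Qed.

Lemma wedge_interior (phi : {linear W -> K^o}) w x :
  wedge (ext_vec w) (interior phi x) + interior phi (wedge (ext_vec w) x)
  = phi w *: x.
Proof.
apply/ffunP=> L; rewrite [LHS]ffunE [RHS]ffunE.
have -> : phi w = \sum_(i < n) coord b i w * phi b`_i.
  rewrite [in LHS](coord_vbasis (memvf w)) linear_sum; apply: eq_bigr => i _.
  exact: linearZ.
rewrite wedge_vecE interiorE.
rewrite big_mkcond [X in _ + X]big_mkcond /= .
have E1 i : (if i \in L then (-1) ^+ below i L * (coord b i w * interior phi x (L :\ i)) else 0)
   = (if i \in L then coord b i w * phi b`_i * x L else 0)
   + \sum_(j < n) (if (i \in L) && (j \notin L) then
      (-1) ^+ (below i L + below j (L :\ i)) * (coord b i w * phi b`_j * x (j |: (L :\ i))) else 0).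
  case: ifP => iL /=; last by rewrite big1 ?addr0.
  rewrite interiorE (bigD1 i) ?in_setD1 ?eqxx //= setD1K // mulrDr mulrDr; congr (_ + _).
    rewrite (belowD1 i iL) ltnn add0n -[below _ _]/(below i (L :\ i)).
    rewrite (ext_coefCA _ _ _ _ erefl).
    by rewrite addnn -signr_odd odd_double mul1r.
  rewrite mulr_sumr mulr_sumr big_mkcond; apply: eq_bigr => j _.
  rewrite in_setD1 negb_and negbK; case: eqP => [->|_] /=.
    by rewrite iL.
  by rewrite andbT; case: ifP => // _; exact: ext_coefCA.
have E2 j : (if j \notin L then (-1) ^+ below j L * (phi b`_j * wedge (ext_vec w) x (j |: L)) else 0)
   = (if j \notin L then coord b j w * phi b`_j * x L else 0)
   + \sum_(i < n) (if (i \in L) && (j \notin L) then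
      (-1) ^+ (below j L + below i (j |: L)) * (coord b i w * phi b`_j * x ((j |: L) :\ i)) else 0).
  case: ifP => jL /=; last by rewrite big1 ?addr0 // => i; rewrite andbF.
  rewrite wedge_vecE (bigD1 j) ?setU11 //= setU1K // mulrDr mulrDr; congr (_ + _).
    rewrite belowU1 // ltnn add0n.
    rewrite (ext_coefCA _ _ _ _ erefl) [phi _ * _]mulrC.
    by rewrite addnn -signr_odd odd_double mul1r.
  rewrite mulr_sumr mulr_sumr big_mkcond; apply: eq_bigr => i _.
  rewrite in_setU1; case: eqP => [->|_] /=.
    by rewrite (negbTE jL).
  by rewrite !andbT; case: ifP => // _; rewrite (ext_coefCA _ _ _ _ erefl) [phi _ * _]mulrC.
under eq_bigr do rewrite E1; under [X in _ + X]eq_bigr do rewrite E2.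
rewrite !big_split /= addrACA [X in _ + (_ + X)]exchange_big /=.
rewrite [X in _ + X](_ : _ = 0) ?addr0.
  rewrite -big_split /GRing.scale /= mulr_suml; apply: eq_bigr => i _.
  by case: ifP; rewrite ?addr0 ?add0r.
rewrite -big_split big1 //= => i _; rewrite -big_split big1 //= => j _.
case: ifP => [/andP[iL jL]|_]; last by rewrite addr0.
rewrite (belowD1 j iL) (belowU1 i jL).
have ij : i != j by apply: contraNneq jL => <-.
have -> : (j |: L) :\ i = j |: (L :\ i).
  by apply/setP=> k; rewrite !inE; case: (k =P j) => [->|] //=; rewrite eq_sym ij.
apply: sign_cancel => //.
case: ltngtP => [||/ord_inj e]; last by rewrite e eqxx in ij.
all: by move=> _; rewrite !oddD; do 2!case: (odd (below _ _)).
Qed.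
End ExteriorTheory.

Section Metric.

Variables (K : fieldType) (V : vectType K).

Definition dual : vectType K := 'Hom(V, K^o).

Definition contraction (v : V) : exterior dual -> exterior dual :=
  interior (fun theta : dual => theta v).

Variable h : {symmetric V}.

Definition flat : 'Hom(V, dual) :=
  linfun (fun v : V => linfun (h v : V -> K^o) : dual).

Definition sharp (theta : dual) : V := (flat^-1)%VF theta.

Definition dual_form (theta eta : dual) : K := h (sharp theta) (sharp eta).

Definition isotropic (theta : dual) : Prop := dual_form theta theta = 0.

(* These conditions determine dia when h is nondegenerate, the vectors        *)
(* generating the exterior algebra; such a dia exists, by                     *)
(* geometric_product_exists.                                                  *)
Definition is_geometric_product
    (dia : {bilinear exterior dual -> exterior dual -> exterior dual}) : Prop :=
  associative dia /\
  forall (theta : dual) (x : exterior dual),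
    dia (ext_vec theta) x
    = wedge (ext_vec theta) x + contraction (sharp theta) x.

Definition orthonormal_frame (p q : nat) (e : (p + q).-tuple V) : Prop :=
  basis_of {:V} e /\
  forall i j : 'I_(p + q),
    h (tnth e i) (tnth e j) = (if (i < p)%N then 1 else -1) *+ (i == j).

Definition has_signature (p q : nat) : Prop :=
  exists e : (p + q).-tuple V, orthonormal_frame e.

End Metric.

Section CliffordProduct.
Variables (K : fieldType) (W : vectType K).
Local Notation n := (\dim {:W}).
Local Notation b := (vbasis {:W}).
Local Notation E := (exterior W).
Implicit Types (w v : W) (x y : E) (I J L : {set 'I_n}).

Lemma wedge_is_linear (z : E) : linear (wedge z : E -> E).
Proof.
move=> k x y; apply/ffunP=> L; rewrite !ffunE scaler_sumr -big_split.
apply: eq_bigr => I _; rewrite !ffunE /GRing.scale /= !mulrDr; congr (_ + _).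
by rewrite [k * (_ * _)]mulrCA [k * (_ * _)]mulrCA.
Qed.
HB.instance Definition _ z := GRing.isLinear.Build K E E _ (wedge z) (wedge_is_linear z).

Lemma interior_is_linear (p : W -> K) : linear (interior p : E -> E).
Proof.
move=> k x y; apply/ffunP=> L; rewrite !ffunE scaler_sumr -big_split.
apply: eq_bigr => I _; rewrite !ffunE /GRing.scale /= !mulrDr; congr (_ + _).
by rewrite [k * (_ * _)]mulrCA [k * (_ * _)]mulrCA.
Qed.
HB.instance Definition _ p := GRing.isLinear.Build K E E _ (interior p) (interior_is_linear p).

Lemma grade_is_linear : linear (@grade_involution K W : E -> E).
Proof.
move=> k x y; apply/ffunP=> L; rewrite !ffunE /GRing.scale /= mulrDr.
by rewrite mulrCA.
Qed.
HB.instance Definition _ := GRing.isLinear.Build K E E _ (@grade_involution K W) grade_is_linear.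

Lemma grade_involutionK x : grade_involution (grade_involution x) = x.
Proof.
by apply/ffunP=> L; rewrite !ffunE mulrA -exprD addnn -signr_odd odd_double mul1r.
Qed.

Lemma grade_wedge w x : grade_involution (wedge (ext_vec w) x) =
  - wedge (ext_vec w) (grade_involution x).
Proof.
apply/ffunP=> L; rewrite ffunE [RHS]ffunE !wedge_vecE mulr_sumr -sumrN.
apply: eq_bigr => i iL; rewrite ffunE (cardsD1 i L) iL exprS.
by rewrite mulN1r mulNr mulrCA; congr (- (_ * _)); rewrite mulrCA.
Qed.

Lemma grade_interior p x : grade_involution (interior p x) =
  - interior p (grade_involution x).
Proof.
apply/ffunP=> L; rewrite ffunE [RHS]ffunE !interiorE mulr_sumr -sumrN.
apply: eq_bigr => i iL; rewrite ffunE cardsU1 iL exprS.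
by rewrite mulN1r mulNr !mulrN opprK mulrCA; congr (_ * _); rewrite mulrCA.
Qed.

Lemma ext_monoE x : x = \sum_I x I *: ext_mono I.
Proof.
apply/ffunP=> L; rewrite sum_ffunE (bigD1 L) //= big1 ?addr0 => [|I IL].
  by rewrite !ffunE eqxx /GRing.scale /= mulr1.
by rewrite !ffunE eq_sym (negbTE IL) /GRing.scale /= mulr0.
Qed.

Lemma ext_const1E : ext_const W 1 = ext_mono set0 :> E.
Proof. by apply/ffunP=> L; rewrite !ffunE. Qed.

Lemma wedge_monoE (i : 'I_n) J : i \notin J ->
  wedge (ext_vec b`_i) (ext_mono J) = (-1) ^+ below i J *: (ext_mono (i |: J) : E).
Proof.
move=> iJ; apply/ffunP=> L; rewrite wedge_vecE !ffunE.
have fb := basis_free (vbasisP {:W}).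
have [->|LiJ] := eqVneq L (i |: J).
  rewrite (bigD1 i) ?setU11 //= big1 ?addr0 => [|j /andP[_ ji]].
    rewrite coord_free // eqxx ffunE setU1K // eqxx mul1r belowU1 // ltnn.
    by [].
  by rewrite coord_free // eq_sym (negbTE ji) mul0r mulr0.
rewrite big1 ?scaler0 // => j jL; rewrite coord_free // ffunE.
case: eqP => [e|_]; last by rewrite mul0r mulr0.
have ji : j = i by [].
case: eqP => [eJ|_]; last by rewrite !mulr0.
by case/eqP: LiJ; rewrite -eJ ji setD1K // -ji.
Qed.

Lemma ext_ind (p : 'I_n -> W -> K) (U : {vspace E}) :
  ext_const W 1 \in U ->
  (forall (i : 'I_n) J, ext_mono J \in U ->
     wedge (ext_vec b`_i) (ext_mono J) + interior (p i) (ext_mono J) \in U) ->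
  forall x, x \in U.
Proof.
rewrite ext_const1E => U0 UH.
suff H m : forall J, (#|J| <= m)%N -> ext_mono J \in U.
  by move=> x; rewrite [x]ext_monoE; apply: memv_suml => I _; apply/memvZ/H/leqnn.
elim: m => [|m IHm] J.
  by rewrite leqn0 cards_eq0 => /eqP ->.
have [->|[i iJ]] := set_0Vmem J; first by [].
rewrite -(setD1K iJ) cardsU1 setD11 add1n ltnS.
move: (J :\ i) (setD11 i J) => L /negbT iL cL.
have := UH i L (IHm _ cL); rewrite wedge_monoE // => H.
have H2 : interior (p i) (ext_mono L) \in U.
  rewrite [interior _ _]ext_monoE; apply: memv_suml => I _.
  have [->|] := eqVneq (interior (p i) (ext_mono L) I) 0.
    by rewrite scale0r mem0v.
  rewrite interiorE => nz; apply/memvZ/IHm/(leq_trans _ cL).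
  have /existsP[j /andP[jI /eqP <-]] : [exists j, (j \notin I) && (j |: I == L)].
    apply: contraNT nz => /existsPn nj; rewrite big1 // => j jI.
    by move: (nj j); rewrite jI ffunE /= => /negbTE ->; rewrite !mulr0.
  by rewrite cardsU1 jI leqnSn.
move: H; rewrite rpredDr //.
move/(memvZ ((-1) ^+ below i L)).
by rewrite scalerA -exprD addnn -signr_odd odd_double scale1r.
Qed.

Variable g : W -> 'Hom(W, K^o).
Hypothesis gC : forall w v, g w v = g v w.

Definition cl w x : E := wedge (ext_vec w) x + interior (g w) x.
Definition cr w x : E :=
  wedge (ext_vec w) (grade_involution x) - interior (g w) (grade_involution x).
Lemma cl_is_linear w : linear (cl w).
Proof. by move=> k x y; rewrite /cl !linearP addrACA scalerDr. Qed.
HB.instance Definition _ w := GRing.isLinear.Build K E E _ (cl w) (cl_is_linear w).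
Lemma cr_is_linear w : linear (cr w).
Proof.
by move=> k x y; rewrite /cr !linearP /= addrACA scalerDr.
Qed.
HB.instance Definition _ w := GRing.isLinear.Build K E E _ (cr w) (cr_is_linear w).

Lemma cl_cr w v x : cl w (cr v x) = cr v (cl w x).
Proof.
rewrite /cl /cr !linearD /= grade_wedge grade_interior !linearN /=.
move: (grade_involution x) => z.
have A := wedge_vec_anti w v z.
have B := interior_anti (g w) (g v) z.
have C := wedge_interior (g v) w z.
have D := wedge_interior (g w) v z.
move: A B C D => /=; rewrite [g v w]gC.
move: (wedge _ (wedge _ _)) (wedge (ext_vec v) (wedge _ _)) => a1 a2.
move: (interior _ (interior _ _)) (interior (g v) (interior _ _)) => b1 b2.
move: (wedge _ (interior _ _)) (interior _ (wedge _ _)) => c1 c2.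
move: (wedge _ (interior _ _)) (interior _ (wedge _ _)) (_ *: _) => d1 d2 s.
move=> /eqP; rewrite addr_eq0 => /eqP -> /eqP; rewrite addr_eq0 => /eqP ->.
move=> /(canRL (addrK _)) -> <-.
rewrite !opprK opprB -!addrA; congr (_ + _).
by rewrite [RHS]addrCA opprD -addrA addKr.
Qed.

Definition lfun_comm (f T : 'End(E)) : 'End(E) := ((T \o f) - (f \o T))%VF.

Lemma lfun_comm_is_linear (f : 'End(E)) : linear (lfun_comm f).
Proof.
move=> k S T; apply/lfunP=> x; rewrite /lfun_comm.
rewrite !(add_lfunE, opp_lfunE, scale_lfunE, comp_lfunE) linearP /=.
by rewrite scalerBr opprD addrACA.
Qed.
HB.instance Definition _ f :=
  GRing.isLinear.Build K 'End(E) 'End(E) _ (lfun_comm f) (lfun_comm_is_linear f).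

Definition cl_comm : {vspace 'End(E)} :=
  (\bigcap_(i < n) lker (linfun (lfun_comm (linfun (cr b`_i)))))%VS.

Lemma cl_commP (T : 'End(E)) :
  reflect (forall (i : 'I_n) x, T (cr b`_i x) = cr b`_i (T x)) (T \in cl_comm).
Proof.
rewrite /cl_comm memvE; apply: (iffP subv_bigcapP) => H i.
  move=> x; have := H i isT; rewrite -memvE memv_ker lfunE => /eqP/lfunP/(_ x).
  rewrite !(add_lfunE, opp_lfunE, comp_lfunE, zero_lfunE) !lfunE /=.
  by move/eqP; rewrite subr_eq0 => /eqP.
move=> _; rewrite -memvE memv_ker lfunE; apply/eqP/lfunP => x.
by rewrite /= !(add_lfunE, opp_lfunE, comp_lfunE, zero_lfunE) !lfunE /= H subrr.
Qed.

Lemma cl_comm_comp (S T : 'End(E)) :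
  S \in cl_comm -> T \in cl_comm -> (S \o T)%VF \in cl_comm.
Proof.
move=> /cl_commP HS /cl_commP HT; apply/cl_commP => i x.
by rewrite !comp_lfunE HT HS.
Qed.

Lemma cl_comm_cl w : linfun (cl w) \in cl_comm.
Proof. by apply/cl_commP => i x; rewrite !lfunE /= cl_cr. Qed.

Definition symbol (T : subvs_of cl_comm) : E := vsval T (ext_const W 1).

Lemma symbol_is_linear : linear symbol.
Proof. by move=> k S T; rewrite /symbol linearP /= add_lfunE scale_lfunE. Qed.
HB.instance Definition _ :=
  GRing.isLinear.Build K (subvs_of cl_comm) E _ symbol symbol_is_linear.

Lemma grade_mono J : grade_involution (ext_mono J : E) = (-1) ^+ #|J| *: (ext_mono J : E).
Proof.
apply/ffunP=> L; rewrite !ffunE /GRing.scale /=.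
by have [->|_] := eqVneq L J => //; rewrite !mulr0.
Qed.

Lemma cl_comm_eq0 (T : 'End(E)) :
  T \in cl_comm -> T (ext_const W 1) = 0 -> T = 0.
Proof.
move=> /cl_commP HT T1; apply/lfunP=> x; rewrite zero_lfunE; apply/eqP.
rewrite -memv_ker; apply: (ext_ind (p := fun i v => - g b`_i v)).
  by rewrite memv_ker T1.
move=> i J; rewrite !memv_ker => /eqP TJ.
have -> : interior (fun v => - g b`_i v) (ext_mono J : E) = - interior (g b`_i) (ext_mono J).
  apply/ffunP=> L; rewrite [RHS]ffunE !interiorE -sumrN; apply: eq_bigr => j _.
  by rewrite mulNr mulrN.
have := HT i (ext_mono J); rewrite TJ linear0.
have -> : cr b`_i (ext_mono J) = (-1) ^+ #|J| *:
    (wedge (ext_vec b`_i) (ext_mono J) - interior (g b`_i) (ext_mono J)).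
  by rewrite /cr grade_mono scalerBr; congr (_ - _); exact: linearZ.
rewrite linearZ /=.
by move/eqP; rewrite scaler_eq0 signr_eq0.
Qed.

Lemma symbol_inj : lker (linfun symbol) == 0%VS.
Proof.
apply/eqP/eqP; rewrite -subv0; apply/subvP => T; rewrite memv_ker lfunE memv0.
move=> /eqP T1; rewrite -(inj_eq val_inj); apply/eqP.
by apply: cl_comm_eq0 => //; apply: subvsP.
Qed.

Lemma symbol_surj : limg (linfun symbol) = fullv.
Proof.
apply/eqP; rewrite eqEsubv subvf /=; apply/subvP => x _.
apply: (ext_ind (p := fun i => g b`_i)).
  have c1 : (\1 : 'End(E))%VF \in cl_comm by apply/cl_commP => i y; rewrite !id_lfunE.
  have -> : ext_const W 1 = linfun symbol (Subvs c1).
    by rewrite lfunE /= /symbol /= id_lfunE.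
  by apply: memv_img; apply: memvf.
move=> i J /memv_imgP[T _ ->]; rewrite -[_ + _]/(cl b`_i _).
have cT := cl_comm_comp (cl_comm_cl b`_i) (subvsP T).
have -> : cl b`_i (linfun symbol T) = linfun symbol (Subvs cT).
  by rewrite !lfunE /= /symbol /= comp_lfunE lfunE.
by apply: memv_img; apply: memvf.
Qed.

Definition clifford_lmul (x : E) : 'End(E) := vsval (((linfun symbol)^-1)%VF x).

Lemma clifford_lmul_comm x : clifford_lmul x \in cl_comm.
Proof. exact: subvsP. Qed.

Lemma clifford_lmul1 x : clifford_lmul x (ext_const W 1) = x.
Proof.
rewrite -[LHS]/(symbol (((linfun symbol)^-1)%VF x)) -[symbol _]lfunE.
by rewrite limg_lfunVK // symbol_surj memvf.
Qed.

Lemma clifford_lmul_unique (T : 'End(E)) x :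
  T \in cl_comm -> T (ext_const W 1) = x -> clifford_lmul x = T.
Proof.
move=> cT T1; apply/eqP; rewrite -subr_eq0; apply/eqP/cl_comm_eq0.
  by rewrite memvB // clifford_lmul_comm.
by rewrite add_lfunE opp_lfunE clifford_lmul1 T1 subrr.
Qed.

Lemma clifford_lmul_is_linear : linear clifford_lmul.
Proof. by move=> k x y; rewrite /clifford_lmul !linearP. Qed.
HB.instance Definition _ :=
  GRing.isLinear.Build K E 'End(E) _ clifford_lmul clifford_lmul_is_linear.

Definition clifford_mul (x y : E) : E := clifford_lmul x y.

Lemma clifford_mul_bilinear : bilinear_for *:%R *:%R clifford_mul.
Proof.
split=> [y k x z|x k y z]; rewrite /clifford_mul; last by rewrite linearP.
by rewrite linearP add_lfunE scale_lfunE.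
Qed.
HB.instance Definition _ :=
  bilinear_isBilinear.Build K E E E *:%R *:%R clifford_mul clifford_mul_bilinear.

Lemma clifford_mulA : associative clifford_mul.
Proof.
move=> x y z; rewrite /clifford_mul -comp_lfunE; congr (fun_of_lfun _ _).
apply/esym/clifford_lmul_unique.
  by apply: cl_comm_comp; apply: clifford_lmul_comm.
by rewrite comp_lfunE clifford_lmul1.
Qed.

Lemma clifford_mul_vec w x : clifford_mul (ext_vec w) x = cl w x.
Proof.
rewrite /clifford_mul (@clifford_lmul_unique (linfun (cl w))) ?cl_comm_cl ?lfunE //=.
rewrite /cl; apply/ffunP=> L; rewrite ffunE wedge_vecE interiorE [RHS]ffunE.
rewrite [X in _ + X]big1 ?addr0 => [|i iL]; last first.
  rewrite ffunE; case: eqP => [/setP/(_ i)|_]; last by rewrite !mulr0.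
  by rewrite setU11 inE.
rewrite big_mkcond; apply: eq_bigr => i _; rewrite ffunE.
have [->|Li] := eqVneq L [set i].
  rewrite set11 setDv eqxx mulr1 (_ : below _ _ = 0%N) ?mul1r //.
  by rewrite (belowD1 i (set11 i)) ltnn setDv /below; apply: eq_card0 => j; rewrite !inE.
case: ifP => // iL; case: eqP => [e|_]; last by rewrite !mulr0.
by case/eqP: Li; rewrite -(setD1K iL) e setU0.
Qed.

End CliffordProduct.

Lemma geometric_product_exists (K : fieldType) (V : vectType K)
    (h : {symmetric V}) :
  (forall u, (forall v, h u v = 0) -> u = 0) ->
  exists dia : {bilinear exterior (dual V) -> exterior (dual V) -> exterior (dual V)},
    is_geometric_product h dia.
Proof.
move=> hnd.
have flatE u v : flat h u v = h u v.
  have Hl (x : V) : linear (h x : V -> K^o) by move=> k y z; exact: linearPr.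
  pose Lh x : {linear V -> K^o} := HB.pack (h x : V -> K^o) (GRing.isLinear.Build K V K^o _ _ (Hl x)).
  pose f (x : V) : dual V := linfun (Lh x).
  have Hf : linear f.
    by move=> k x y; apply/lfunP=> z; rewrite /f add_lfunE scale_lfunE !lfunE /= linearPl.
  pose F : {linear V -> dual V} := HB.pack f (GRing.isLinear.Build K V (dual V) _ _ Hf).
  by rewrite -[flat h]/(linfun F) lfunE /= lfunE.
have sharpK t : flat h (sharp h t) = t.
  rewrite /sharp limg_lfunVK //; suff -> : limg (flat h) = fullv by rewrite memvf.
  apply/eqP; rewrite eqEdim subvf /= limg_dim_eq.
    by rewrite !dimvf [X in (X <= _)%N]muln1.
  apply/eqP; rewrite capfv -subv0; apply/subvP => u; rewrite memv_ker memv0.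
  by move=> /eqP fu; apply/eqP/hnd => v; rewrite -flatE fu zero_lfunE.
have Hl (v : V) : linear (fun t : dual V => t v : K^o).
  by move=> k x y; rewrite add_lfunE scale_lfunE.
pose Lv (v : V) : {linear dual V -> K^o} :=
  HB.pack (fun t : dual V => t v : K^o) (GRing.isLinear.Build K (dual V) K^o _ _ (Hl v)).
pose g (t : dual V) : 'Hom(dual V, K^o) := linfun (Lv (sharp h t)).
have gE t s : g t s = s (sharp h t) by rewrite /g lfunE.
have gC t s : g t s = g s t.
  rewrite !gE -{1}(sharpK s) -{2}(sharpK t) !flatE.
  by have := hermC h (sharp h s) (sharp h t); rewrite expr0 mul1r.
exists (clifford_mul g); split; first exact: clifford_mulA.
move=> t x; rewrite [LHS](clifford_mul_vec gC) /cl; congr (_ + _).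
by apply/ffunP=> L; rewrite !interiorE; apply: eq_bigr => i _; rewrite gE.
Qed.

Section VolumeForm.

Variables (K : realFieldType) (V : vectType K).

(* An orientation is represented by any basis o belonging to it.              *)
Definition positively_oriented (n : nat) (o e : n.-tuple V) : Prop :=
  0 < \det (\matrix_(i < n, j < n) coord o i (tnth e j)).

Definition coframe (n : nat) (e : n.-tuple V) (i : 'I_n) : dual V :=
  linfun (coord e i : V -> K^o).

(* The unit volume form of the orientation of o: it does not depend on the    *)
(* positively oriented orthonormal frame e.                                   *)
Definition is_volume_form (h : {symmetric V}) (p q : nat)
    (o : (p + q).-tuple V) (nu : exterior (dual V)) : Prop :=
  exists e : (p + q).-tuple V,
    [/\ orthonormal_frame h e, positively_oriented o e
      & nu = \big[@wedge K (dual V)/ext_const (dual V) 1]_(i < p + q)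
               ext_vec (coframe e i)].

End VolumeForm.

Section SpinorSquare.

Variables (K : fieldType) (V S : vectType K).

Local Notation Cl := (exterior (dual V)).

Variables (dia : {bilinear Cl -> Cl -> Cl}) (nu : Cl) (l : K).
Variables (gamma : 'Hom(Cl, 'End(S))) (B : {symmetric S}).

Record irreducible_paired_module : Prop := {
  module_dim : \dim {:S} = 8%N;
  module_unit : gamma (ext_const (dual V) 1) = \1%VF;
  module_mul : forall x y, gamma (dia x y) = (gamma x \o gamma y)%VF;
  module_irreducible : forall U : {vspace S},
    (forall x, (gamma x @: U <= U)%VS) -> U = 0%VS \/ U = fullv;
  module_volume : gamma nu = l *: \1%VF;
  pairing_nondegenerate : forall u, (forall v, B u v = 0) -> u = 0;
  pairing_adjoint : forall x u v,
    B (gamma x u) v = B u (gamma (grade_involution (reversion x)) v) }.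

Definition half_proj (x : Cl) : Cl := 2^-1 *: (x + l *: dia nu x).

Definition Psi_lt : 'Hom(subvs_of (ext_lt (dual V) 4), 'End(S)) :=
  linfun (fun x => gamma (half_proj (vsval x))).

(* The endomorphism eps (x) B (-, eps).                                       *)
Definition spinor_tensor (eps : S) : 'End(S) :=
  linfun (fun chi : S => B chi eps *: eps).

(* lfun inversion is total: it inverts Psi_lt because Psi_lt is bijective     *)
(* for an irreducible_paired_module in signature (4, 3).                      *)
Definition spinor_square (mu : K) (eps : S) : Cl :=
  vsval ((Psi_lt^-1)%VF (mu *: spinor_tensor eps)).

Definition is_square_of (x : Cl) (eps : S) : Prop :=
  exists mu : K, (mu = -1 \/ mu = 1) /\ x = spinor_square mu eps.

End SpinorSquare.

(* Main.v *)
Require Import Defs.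
From HB Require Import structures.
From mathcomp Require Import all_boot all_order all_algebra.
From mathcomp Require Import reals.
Import Order.TTheory GRing.Theory Num.Theory.
Local Open Scope ring_scope.

(* Since gamma (l nu) is the identity, Psi_lt is the restriction of gamma to    *)
(* forms of degree at most 3. It is injective there: gamma x = 0 implies        *)
(* gamma x^* = 0 for the adjoint x^*, which separates degrees {0, 3} from       *)
(* {1, 2}, and adding or subtracting left and right Clifford multiplication by  *)
(* a vector isolates the top piece, which can be wedged up to the volume form,  *)
(* on which gamma does not vanish.                                              *)
(*                                                                              *)
(* For independent, isotropic, orthogonal w1, w2, w3 the endomorphism           *)
(* T = gamma (w1 /\ w2 /\ w3) is the composite of the anticommuting square-zero  *)
(* maps gamma wi, each with a contracting homotopy, so its image is the         *)
(* intersection of their kernels, of dimension 8 / 2^3 = 1. As T is symmetric   *)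
(* for B, it is a multiple of eps (x) B(-, eps) for any nonzero eps killed by   *)
(* the wi. Conversely, for isotropic eps the vectors gamma w eps span a totally *)
(* isotropic subspace of the 8-dimensional module, so the w killing eps form a  *)
(* space of dimension at least 7 - 4 = 3, on which the metric vanishes.         *)

(** A form of degree at most 3 is determined by its image under [gamma], so being a square means
    that [gamma alpha] is plus or minus a rank-one operator ([spinor_square_unique], resting on
    [gamma_lt4_inj]). The bridge is [null_triple_square]: if independent [w1], [w2], [w3] kill a
    nonzero spinor [s], their wedge acts as a nonzero multiple [k] of the rank-one operator of [s].
    From an isotropic spinor, [annihilator_dim] supplies the triple, and [k] is absorbed by
    rescaling [w1]. From a triple, [null_triple_spinor] supplies the spinor; rescaling it absorbs
    [|k|], and the sign of [k] becomes [mu]. Dependent triples and the zero spinor both give the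
    form 0. *)

Set Implicit Arguments.
Unset Strict Implicit.
Unset Printing Implicit Defensive.

(** * Linear algebra *)

Lemma addr_subr_eq0 (K : numFieldType) (M : lmodType K) (x y : M) :
  x + y = 0 -> x - y = 0 -> x = 0 /\ y = 0.
Proof.
move=> e1 e2; have x0 : x = 0.
  apply/eqP; have := congr2 +%R e1 e2.
  rewrite addrACA subrr !addr0 -mulr2n => /eqP.
  by rewrite -scaler_nat scaler_eq0 pnatr_eq0.
by split=> //; move: e1; rewrite x0 add0r.
Qed.

(** The values of the forms on a basis make a matrix with independent rows; the columns of a right
    inverse are the coordinates of the dual vectors. *)
Lemma free_dual_vectors (K : fieldType) (V : vectType K) (n : nat)
    (X : n.-tuple 'Hom(V, K^o)) :
  free X -> exists v : 'I_n -> V, forall i j : 'I_n, X`_i (v j) = (i == j)%:R.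
Proof.
move=> /freeP fX; pose b := vbasis {:V}.
pose A : 'M[K]_(n, \dim {:V}) := \matrix_(i, k) (X`_i b`_k : K).
have /row_freeP[B AB] : row_free A.
  apply: inj_row_free => r rA; apply/rowP => j; rewrite [RHS]mxE; apply: (fX (fun i => r 0 i)).
  apply/lfunP => u; rewrite sum_lfunE zero_lfunE [u](coord_vbasis (memvf u)).
  under eq_bigr do rewrite linear_sum.
  rewrite exchange_big big1 //= => k _.
  have := congr1 (fun M : 'rV_ _ => M 0 k) rA; rewrite !mxE => e.
  transitivity (coord (vbasis {:V}) k u * 0); last by rewrite mulr0.
  rewrite -[in RHS]e mulr_sumr; apply: eq_bigr => i _.
  by rewrite scale_lfunE linearZ /= !mxE /GRing.scale /= mulrCA.
exists (fun j => \sum_k B k j *: b`_k) => i j.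
have := congr1 (fun M : 'M_n => M i j) AB; rewrite !mxE => <-.
rewrite linear_sum; apply: eq_bigr => k _.
by rewrite linearZ /= mxE /GRing.scale /= mulrC.
Qed.

(** The contracting homotopy [g] makes [f] exact on [U]: if [f u = 0], then [u = f (g u)]. *)
Lemma homotopy_img_ker (K : fieldType) (S : vectType K) (U : {vspace S})
    (f g : 'End(S)) :
  (forall u, u \in U -> f u \in U) -> (forall u, u \in U -> g u \in U) ->
  (forall u, u \in U -> f (f u) = 0) ->
  (forall u, u \in U -> f (g u) + g (f u) = u) ->
  (f @: U = U :&: lker f)%VS.
Proof.
move=> fU gU ff fg; apply/eqP; rewrite eqEsubv; apply/andP; split; apply/subvP.
  by move=> _ /memv_imgP[u uU ->]; rewrite memv_cap fU //= memv_ker ff.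
move=> u; rewrite memv_cap => /andP[uU]; rewrite memv_ker => /eqP fu.
by rewrite -(fg u uU) fu linear0 addr0 memv_img ?gU.
Qed.

Lemma homotopy_dim (K : fieldType) (S : vectType K) (U : {vspace S})
    (f g : 'End(S)) :
  (forall u, u \in U -> f u \in U) -> (forall u, u \in U -> g u \in U) ->
  (forall u, u \in U -> f (f u) = 0) ->
  (forall u, u \in U -> f (g u) + g (f u) = u) ->
  (\dim U = (\dim (U :&: lker f)).*2)%N.
Proof.
move=> fU gU ff fg.
by rewrite -{1}(limg_ker_dim f U) (homotopy_img_ker fU gU ff fg) addnn.
Qed.

(** [M] pairs a basis of [U] with one of [S], and [N] holds the coordinates of the basis of [U].
    Both have rank [\dim U], and [M *m N] is the Gram matrix of [U], which vanishes. *)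
Lemma isotropic_subspace_dim (K : fieldType) (S : vectType K) (B : {symmetric S})
    (U : {vspace S}) :
  (forall u, (forall v, B u v = 0) -> u = 0) ->
  (forall u v, u \in U -> v \in U -> B u v = 0) ->
  ((\dim U).*2 <= \dim {:S})%N.
Proof.
move=> Bnd BU; pose b := vbasis {:S}; pose c := vbasis U.
pose M : 'M[K]_(\dim U, \dim {:S}) := \matrix_(i, k) B c`_i b`_k.
pose N : 'M[K]_(\dim {:S}, \dim U) := \matrix_(k, j) coord b k c`_j.
have cfree := basis_free (vbasisP U); have cE i : c`_i \in U.
  case: (ltnP i (\dim U)) => iU; last by rewrite nth_default ?mem0v ?size_tuple.
  by apply: vbasis_mem; rewrite mem_nth ?size_tuple.
have MN : M *m N = 0.
  apply/matrixP => i j; rewrite !mxE; transitivity (B c`_i c`_j); last by rewrite BU.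
  rewrite [in RHS](coord_vbasis (memvf c`_j)) linear_sumr /=.
by apply: eq_bigr => k _; rewrite !mxE linearZr_LR /= mulrC.
have rM : row_free M.
  apply: inj_row_free => r rA; apply/rowP => j; rewrite [RHS]mxE; move/freeP: cfree.
  apply=> //; apply: (Bnd (\sum_i r 0 i *: c`_i)) => v.
  rewrite [v](coord_vbasis (memvf v)) linear_sumr big1 //= => k _.
  rewrite linearZr_LR /= linear_sumlz /=.
  have := congr1 (fun M : 'rV_ _ => M 0 k) rA; rewrite !mxE => e.
  rewrite (_ : \sum_i _ = 0) ?mulr0 // -[RHS]e.
  by apply: eq_bigr => i _; rewrite linearZl_LR /= !mxE.
have rN : row_free N^T.
  apply: inj_row_free => r rA; apply/rowP => j; rewrite [RHS]mxE; move/freeP: cfree.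
  apply=> //; rewrite [LHS](coord_vbasis (memvf _)) big1 // => k _.
  rewrite linear_sum; have := congr1 (fun M : 'rV_ _ => M 0 k) rA; rewrite !mxE => e.
  rewrite (_ : \sum_i _ = 0) ?scale0r // -[RHS]e.
  by apply: eq_bigr => i _; rewrite linearZ /= !mxE.
have := mulmx0_rank_max MN.
by rewrite (eqP rM) -mxrank_tr (eqP rN) addnn.
Qed.

(** [linfun] accepts any function, so evaluating it takes a proof of linearity. *)
Lemma spinor_tensorE (K : fieldType) (S : vectType K) (B : {symmetric S}) (s t : S) :
  spinor_tensor B s t = B t s *: s.
Proof.
have lin : linear (fun t => B t s *: s).
  by move=> k u v; rewrite linearPl scalerDl scalerA.
pose F : {linear S -> S} := HB.pack (fun t => B t s *: s)
  (GRing.isLinear.Build K S S _ _ lin).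
by rewrite -[spinor_tensor B s]/(linfun F) lfunE.
Qed.

Lemma spinor_tensorZ (K : fieldType) (S : vectType K) (B : {symmetric S}) k (s : S) :
  spinor_tensor B (k *: s) = k ^+ 2 *: spinor_tensor B s.
Proof.
apply/lfunP => t; rewrite scale_lfunE !spinor_tensorE linearZr_LR /= !scalerA.
by congr (_ *: _); rewrite mulrAC.
Qed.

(** Write [T u = d *: s]. Symmetry against a fixed [v] with [B s v != 0] shows that [d] is
    proportional to [B u s], with a factor independent of [u]. *)
Lemma symmetric_rank_one (K : fieldType) (S : vectType K) (B : {symmetric S})
    (T : 'End(S)) (s : S) :
  (forall u, (forall v, B u v = 0) -> u = 0) ->
  (forall u v, B (T u) v = B u (T v)) -> s != 0 -> limg T = <[s]>%VS ->
  exists2 k, k != 0 & T = k *: spinor_tensor B s.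
Proof.
move=> Bnd Tsym s0 Ts.
have TP u : exists a, T u = a *: s by apply/vlineP; rewrite -Ts memv_img ?memvf.
have [i Bsi] : exists i : 'I_(\dim {:S}), B s (vbasis {:S})`_i != 0.
  apply/existsP; apply: contraNT s0; rewrite negb_exists => /forallP Bs0.
  apply/eqP/Bnd => v; rewrite [v](coord_vbasis (memvf v)) linear_sumr big1 //= => i _.
  by have := Bs0 i; rewrite negbK linearZr_LR /= => /eqP ->; rewrite mulr0.
move: (_`_i) Bsi => v Bsv; have [a Tv] := TP v.
have TE : T = (a / B s v) *: spinor_tensor B s.
  apply/lfunP => u; rewrite scale_lfunE spinor_tensorE scalerA.
  have [d Tu] := TP u; rewrite Tu; congr (_ *: _).
  have := Tsym u v; rewrite Tu Tv linearZl_LR linearZr_LR /= => e.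
  by rewrite mulrAC -e mulfK.
exists (a / B s v) => //; apply: contraNneq s0 => k0.
have /memv_imgP[u _ ->] : s \in limg T by rewrite Ts memv_line.
by rewrite TE k0 scale0r zero_lfunE.
Qed.

(** * Degrees in the exterior algebra *)

Section Graded.
Variables (K : fieldType) (W : vectType K).
Local Notation n := (\dim {:W}).
Local Notation b := (vbasis {:W}).
Implicit Types (w : W) (x : exterior W) (I : {set 'I_n}).

Lemma ext_degP k x :
  reflect (forall I, #|I| != k -> x I = 0) (x \in ext_deg W k).
Proof.
apply: (iffP idP) => [xk I Ik|x0].
  pose X := in_tuple [seq ext_mono A | A <- enum [set A : {set 'I_n} | #|A| == k]].
  rewrite (@coord_span _ _ _ X x xk) sum_ffunE big1 // => i _; rewrite ffunE.
  have /mapP[A] : X`_i \in X by rewrite mem_nth ?size_tuple.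
  rewrite mem_enum inE => /eqP Ak ->; rewrite ffunE.
  by case: eqP => [e|_]; [rewrite e Ak eqxx in Ik | rewrite scaler0].
rewrite [x]ext_monoE; apply: memv_suml => I _.
have [Ik|/x0 ->] := boolP (#|I| == k); last by rewrite scale0r mem0v.
by apply/memvZ/memv_span/map_f; rewrite mem_enum inE.
Qed.

Lemma ext_ltP k x :
  reflect (forall I, (k <= #|I|)%N -> x I = 0) (x \in ext_lt W k).
Proof.
apply: (iffP idP) => [/memv_sumP[y yk ->] I kI|x0].
  rewrite sum_ffunE big1 // => i _; move/ext_degP: (yk i isT); apply.
  by rewrite gtn_eqF // (leq_trans (ltn_ord i)).
rewrite [x]ext_monoE; apply: memv_suml => I _.
have [/x0 ->|Ik] := leqP k #|I|; first by rewrite scale0r mem0v.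
apply/memvZ; apply: (subvP (sumv_sup (Ordinal Ik) _ (subvv _))) => //.
by apply/ext_degP => J JI; rewrite ffunE; case: eqP => // e; rewrite e eqxx in JI.
Qed.

Lemma ext_deg_sub_lt k m x : (k < m)%N -> x \in ext_deg W k -> x \in ext_lt W m.
Proof.
move=> km /ext_degP xk; apply/ext_ltP => I mI.
by apply: xk; rewrite gtn_eqF // (leq_trans km).
Qed.

Lemma ext_deg0 : ext_const W 1 \in ext_deg W 0.
Proof. by apply/ext_degP => I; rewrite ffunE cards_eq0 => /negbTE ->. Qed.

Lemma wedge_ext_deg w k x :
  x \in ext_deg W k -> wedge (ext_vec w) x \in ext_deg W k.+1.
Proof.
move=> /ext_degP xk; apply/ext_degP => I Ik; rewrite wedge_vecE big1 // => i iI.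
by rewrite xk ?mulr0 //; move: Ik; rewrite (cardsD1 i) iI.
Qed.

Lemma ext_vec_deg w : ext_vec w \in ext_deg W 1.
Proof. by rewrite -(wedge1r (ext_vec w)) wedge_ext_deg ?ext_deg0. Qed.

Lemma interior_ext_deg p k x :
  x \in ext_deg W k.+1 -> interior p x \in ext_deg W k.
Proof.
move=> /ext_degP xk; apply/ext_degP => I Ik; rewrite interiorE big1 // => i iI.
by rewrite xk ?mulr0 // cardsU1 iI.
Qed.

Lemma interior_ext_deg0 p x : x \in ext_deg W 0 -> interior p x = 0.
Proof.
move=> /ext_degP xk; apply/ffunP => I; rewrite interiorE ffunE big1 // => i iI.
by rewrite xk ?mulr0 // cardsU1 iI.
Qed.

Lemma grade_ext_deg k x : x \in ext_deg W k ->
  grade_involution x = (-1) ^+ k *: x.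
Proof.
move=> /ext_degP xk; apply/ffunP => I; rewrite !ffunE /GRing.scale /=.
by have [->|/xk ->] := eqVneq #|I| k; rewrite ?mulr0.
Qed.

Lemma wedge_eq0 k x : (k < n)%N -> x \in ext_deg W k ->
  (forall w, wedge (ext_vec w) x = 0) -> x = 0.
Proof.
move=> kn /ext_degP xk wx0; apply/ffunP => I; rewrite [RHS]ffunE.
have [Ik|/xk //] := eqVneq #|I| k.
have [i iI] : exists i, i \notin I.
  apply/existsP; apply: contraLR kn; rewrite negb_exists -leqNgt -Ik.
  move=> /forallP H; rewrite (_ : I = setT) ?cardsT ?card_ord //.
  by apply/setP => i; rewrite inE; have := H i; rewrite negbK.
(* Up to sign, this coefficient of the wedge is [x I]. *)
have /ffunP/(_ (i |: I)) := wx0 b`_i.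
have fb := basis_free (vbasisP {:W}).
rewrite wedge_vecE ffunE (bigD1 i) ?setU11 //= setU1K // coord_free // eqxx mul1r.
rewrite big1 ?addr0 => [|j /andP[_ ji]].
  by move/eqP; rewrite mulf_eq0 signr_eq0 => /eqP.
by rewrite coord_free // eq_sym (negbTE ji) mul0r mulr0.
Qed.

Lemma wedge_vec_sqr w x : (2%:R : K) != 0 ->
  wedge (ext_vec w) (wedge (ext_vec w) x) = 0.
Proof.
move=> two; apply/eqP; have := wedge_vec_anti w w x; rewrite -mulr2n => /eqP.
by rewrite -scaler_nat scaler_eq0 (negbTE two).
Qed.

Lemma ext_vec_is_linear : linear (@ext_vec K W).
Proof.
move=> k w v; apply/ffunP => I; rewrite !ffunE scaler_sumr -big_split.
apply: eq_bigr => i _; rewrite linearP /= mulrnDl; congr (_ + _).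
by rewrite /GRing.scale /= mulrnAr.
Qed.
HB.instance Definition _ :=
  GRing.isLinear.Build K W (exterior W) _ (@ext_vec K W) ext_vec_is_linear.

Lemma wedge_vecDl w v x :
  wedge (ext_vec (w + v)) x = wedge (ext_vec w) x + wedge (ext_vec v) x.
Proof.
apply/ffunP => L; rewrite [RHS]ffunE !wedge_vecE -big_split; apply: eq_bigr => i _.
by rewrite linearD /= mulrDl mulrDr.
Qed.

Lemma wedge_vecZl k w x : wedge (ext_vec (k *: w)) x = k *: wedge (ext_vec w) x.
Proof.
apply/ffunP => L; rewrite [RHS]ffunE !wedge_vecE scaler_sumr; apply: eq_bigr => i _.
by rewrite linearZ /= /GRing.scale /= -!mulrA mulrCA.
Qed.

Lemma wedge3_free w1 w2 w3 : (2%:R : K) != 0 ->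
  wedge (ext_vec w1) (wedge (ext_vec w2) (ext_vec w3)) != 0 -> free [:: w1; w2; w3].
Proof.
move=> two; have sqr w x := wedge_vec_sqr w x two.
apply: contraR; rewrite !free_cons nil_free andbT span_nil span_cons span_seq1 memv0.
(* In a dependent triple some entry lies in the span of the later ones; every term of the wedge then
   has a repeated or zero factor. *)
rewrite !negb_and !negbK => /or3P[/memv_addP[_ /vlineP[a ->] [_ /vlineP[d ->] ->]]
  |/vlineP[a ->]|/eqP ->].
- rewrite wedge_vecDl !wedge_vecZl sqr scaler0 add0r.
  have /eqP := wedge_vec_anti w3 w2 (ext_vec w3); rewrite addr_eq0 => /eqP ->.
  by rewrite -{2}(wedge1r (ext_vec w3)) sqr linear0 oppr0 scaler0.
- by rewrite wedge_vecZl -{2}(wedge1r (ext_vec w3)) sqr scaler0 linear0.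
by rewrite !linear0.
Qed.

Lemma ext_deg_top x y : y \in ext_deg W n -> x \in ext_deg W n -> y != 0 ->
  exists c, x = c *: y.
Proof.
move=> /ext_degP yn /ext_degP xn y0.
have zT (z : exterior W) : (forall I, #|I| != n -> z I = 0) ->
    z = z setT *: (ext_mono setT : exterior W).
  move=> zn; apply/ffunP => I; rewrite !ffunE /GRing.scale /=.
  have [->|IT] := eqVneq I setT; first by rewrite mulr1.
  rewrite mulr0 zn //; apply: contraNneq IT => In.
  by rewrite eqEcard subsetT cardsT card_ord In /=.
have yT : y setT != 0 by apply: contraNneq y0 => e; rewrite (zT y yn) e scale0r.
exists (x setT / y setT).
transitivity ((x setT / y setT) *: (y setT *: (ext_mono setT : exterior W))).
  by rewrite scalerA divfK // -zT.
by rewrite -zT.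
Qed.

Lemma big_wedge_deg (I : eqType) (r : seq I) (F : I -> W) :
  \big[@wedge K W/ext_const W 1]_(i <- r) ext_vec (F i) \in ext_deg W (size r).
Proof.
elim: r => [|i r IHr]; first by rewrite big_nil ext_deg0.
by rewrite big_cons wedge_ext_deg.
Qed.

End Graded.

(** * Clifford modules *)

Section CliffordModule.
Variables (K : numFieldType) (W S : vectType K) (g : W -> 'Hom(W, K^o)).
Variable gamma : 'Hom(exterior W, 'End(S)).
Local Notation n := (\dim {:W}).
Local Notation b := (vbasis {:W}).
Implicit Types (w v : W) (x y : exterior W) (s : S).

Hypothesis gC : forall w v, g w v = g v w.
Hypothesis gamma1 : gamma (ext_const W 1) = \1%VF.
Hypothesis gamma_cl : forall w x,
  gamma (cl g w x) = (gamma (ext_vec w) \o gamma x)%VF.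

Local Notation c w := (gamma (ext_vec w)).

(* Left and right Clifford multiplication by vectors commute, so right        *)
(* multiplication cr is determined by its value at 1.                         *)
Lemma gamma_cr w x : gamma (cr g w x) = (gamma x \o c w)%VF.
Proof.
have F_lin s : linear (fun y => gamma (cr g w y) s - gamma y (c w s)).
  move=> k y z; rewrite !linearP /= !add_lfunE !scale_lfunE.
  by rewrite scalerBr opprD addrACA.
pose F s : {linear exterior W -> S} := HB.pack
  (fun y => gamma (cr g w y) s - gamma y (c w s))
  (GRing.isLinear.Build K (exterior W) S _ _ (F_lin s)).
have FE s y : F s y = (gamma (cr g w y) - (gamma y \o c w))%VF s.
  by rewrite add_lfunE opp_lfunE comp_lfunE.
apply/lfunP => s; rewrite comp_lfunE; apply/eqP; rewrite -subr_eq0.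
rewrite -[_ - _]/(F s x) -lfunE -memv_ker.
(* [ext_ind] needs a subspace, so the condition on all spinors is imposed on a basis of [S]. *)
pose U := (\bigcap_(i < \dim {:S}) lker (linfun (F (vbasis {:S})`_i)))%VS.
have UP y : reflect (forall t, F t y = 0) (y \in U).
  rewrite memvE; apply: (iffP subv_bigcapP) => H i.
    rewrite [i](coord_vbasis (memvf i)).
    rewrite FE linear_sum big1 // => j _; rewrite linearZ /= -FE.
    by have := H j isT; rewrite -memvE memv_ker lfunE => /eqP ->; rewrite scaler0.
  by move=> _; rewrite -memvE memv_ker lfunE H.
rewrite memv_ker lfunE; apply/eqP; move: s; apply/UP.
apply: (ext_ind (p := fun i => g b`_i)).
  apply/UP => t; rewrite /= gamma1 id_lfunE; apply/eqP; rewrite subr_eq0; apply/eqP.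
  congr (gamma _ t); rewrite /cr (grade_ext_deg (ext_deg0 W)) scale1r wedge1r.
  by rewrite (interior_ext_deg0 _ (ext_deg0 W)) subr0.
move=> i J /UP HJ; apply/UP => t; rewrite /=.
rewrite -[_ + interior _ _]/(cl g b`_i (ext_mono J)) -cl_cr // !gamma_cl !comp_lfunE -linearB /=.
by have := HJ t; rewrite /= => ->; rewrite linear0.
Qed.

Lemma interior_vec w v : interior (g w) (ext_vec v) = g w v *: ext_const W 1.
Proof.
have := wedge_interior (g w) v (ext_const W 1); rewrite wedge1r => <-.
by rewrite (interior_ext_deg0 _ (ext_deg0 W)) linear0 add0r.
Qed.

Lemma clifford_relation w v s : c w (c v s) + c v (c w s) = (g w v *+ 2) *: s.
Proof.
rewrite -!comp_lfunE -!gamma_cl -add_lfunE -linearD /cl !interior_vec (gC v w).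
have := wedge_vec_anti w v (ext_const W 1); rewrite !wedge1r addrACA => ->.
rewrite add0r -mulr2n scalerMnl linearZ /= scale_lfunE gamma1.
by rewrite id_lfunE.
Qed.

Lemma gamma_sqr w s : g w w = 0 -> c w (c w s) = 0.
Proof.
move=> gw; have := clifford_relation w w s; rewrite gw mul0rn scale0r -mulr2n.
by move/eqP; rewrite -scaler_nat scaler_eq0 pnatr_eq0 => /eqP.
Qed.

Lemma gamma_anti w v s : g w v = 0 -> c w (c v s) = - c v (c w s).
Proof.
by move=> gw; apply/eqP; rewrite -addr_eq0 clifford_relation gw mul0rn scale0r.
Qed.

(** Orthogonality kills the contraction terms of [cl]. *)
Lemma gamma_wedge3 w1 w2 w3 : g w1 w2 = 0 -> g w1 w3 = 0 -> g w2 w3 = 0 ->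
  gamma (wedge (ext_vec w1) (wedge (ext_vec w2) (ext_vec w3)))
  = (c w1 \o (c w2 \o c w3))%VF.
Proof.
move=> g12 g13 g23; rewrite -!gamma_cl; congr (gamma _).
rewrite /cl interior_vec g23 scale0r addr0.
have := wedge_interior (g w1) w2 (ext_vec w3).
by rewrite /= interior_vec g13 scale0r linear0 add0r g12 scale0r => ->; rewrite addr0.
Qed.

(** Left and right Clifford multiplication by [w] preserve the kernel of [gamma]. For [x] even and
    [y] odd the two products differ only in the sign of one group of terms, so their sum and
    difference isolate both groups. *)
Lemma gamma_ker_parity w x y :
  grade_involution x = x -> grade_involution y = - y -> gamma (x + y) = 0 ->
  gamma (wedge (ext_vec w) y + interior (g w) x) = 0 /\
  gamma (wedge (ext_vec w) x + interior (g w) y) = 0.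
Proof.
move=> gx gy gxy; set p := gamma _; set q := gamma _.
have e1 : q + p = 0.
  transitivity (gamma (cl g w (x + y))); last by rewrite gamma_cl gxy comp_lfun0r.
  rewrite -[LHS]linearD; congr (gamma _); rewrite /cl !linearD /= [LHS]addrACA.
  by congr (_ + _); rewrite addrC.
have e2 : q - p = 0.
  transitivity (gamma (cr g w (x + y))); last by rewrite gamma_cr gxy comp_lfun0l.
  rewrite -[LHS]linearB; congr (gamma _).
  rewrite /cr (linearD (@grade_involution K W)) /= gx gy !linearB /=.
  by rewrite opprK opprD addrACA [in RHS](addrC (- _)).
have q0 : q = 0.
  apply/eqP; have := congr2 +%R e1 e2.
  rewrite addrACA subrr !addr0 -mulr2n => /eqP.
  by rewrite -scaler_nat scaler_eq0 pnatr_eq0.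
by split=> //; move: e1; rewrite q0 add0r.
Qed.

Lemma gamma_ker_wedge k w x : x \in ext_deg W k -> gamma x = 0 ->
  gamma (wedge (ext_vec w) x) = 0.
Proof.
move=> xk gx; have := grade_ext_deg xk; rewrite -signr_odd; case: (odd k) => gr.
  have [] := @gamma_ker_parity w 0 x; rewrite ?add0r ?linear0 ?addr0 //.
  by rewrite gr expr1 scaleN1r.
have [] := @gamma_ker_parity w x 0; rewrite ?addr0 ?linear0 ?oppr0 ?addr0 //.
by rewrite gr expr0 scale1r.
Qed.

(** The factor 2 is that of [clifford_relation]: the action of [v i] becomes a contracting homotopy
    for that of the i-th vector of [X]. *)
Lemma clifford_dual_vectors m (X : m.-tuple W) :
  (forall w, (forall v, g w v = 0) -> w = 0) -> free X ->
  exists v : 'I_m -> W, forall i j : 'I_m, g X`_i (v j) *+ 2 = (i == j)%:R.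
Proof.
move=> gnd /freeP fX; pose Y := [tuple of map g X].
have YE (i : 'I_m) : Y`_i = g X`_i by rewrite (nth_map 0) ?size_tuple.
have [|v vY] := @free_dual_vectors _ _ _ Y.
  apply/freeP => k; under eq_bigr do rewrite YE.
  move=> /lfunP gk; apply: fX; apply: gnd => v; rewrite gC linear_sum /=.
  rewrite -[RHS](zero_lfunE _ v) -gk sum_lfunE; apply: eq_bigr => i _.
  by rewrite scale_lfunE linearZ /= gC.
exists (fun j => 2^-1 *: v j) => i j; rewrite linearZ /= -YE vY -scaler_nat.
by rewrite scalerA divff ?pnatr_eq0 // scale1r.
Qed.

Lemma null_vector_img_dim (U : {vspace S}) w v :
  g w w = 0 -> g w v *+ 2 = 1 ->
  (forall s, s \in U -> c w s \in U) -> (forall s, s \in U -> c v s \in U) ->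
  (c w @: U = U :&: lker (c w))%VS /\ (\dim U = (\dim (U :&: lker (c w))).*2)%N.
Proof.
move=> gw gwv wU vU.
have ww s : s \in U -> c w (c w s) = 0 by move=> _; apply: gamma_sqr.
have wv s : s \in U -> c w (c v s) + c v (c w s) = s.
  by move=> _; rewrite clifford_relation gwv scale1r.
by split; [apply: homotopy_img_ker wU vU ww wv | apply: homotopy_dim wU vU ww wv].
Qed.

Lemma lker_gamma_stable w v s : g w v = 0 ->
  s \in lker (c w) -> c v s \in lker (c w).
Proof.
move=> gwv; rewrite !memv_ker => /eqP ws.
by rewrite gamma_anti // ws linear0 oppr0.
Qed.

(** The kernels are intersected one at a time. Orthogonality keeps each intersection stable under
    the next vector and its dual vector, so every step halves the dimension. *)
Lemma null_triple_img w1 w2 w3 :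
  (forall w, (forall v, g w v = 0) -> w = 0) -> free [:: w1; w2; w3] ->
  g w1 w1 = 0 -> g w2 w2 = 0 -> g w3 w3 = 0 ->
  g w1 w2 = 0 -> g w1 w3 = 0 -> g w2 w3 = 0 ->
  limg (c w1 \o (c w2 \o c w3)) = (lker (c w3) :&: lker (c w2) :&: lker (c w1))%VS
  /\ (\dim {:S} = 8 * \dim (limg (c w1 \o (c w2 \o c w3))))%N.
Proof.
move=> gnd fw g11 g22 g33 g12 g13 g23.
have [v vE] := @clifford_dual_vectors _ [tuple w1; w2; w3] gnd fw.
pose i1 : 'I_3 := ord0; pose i2 : 'I_3 := lift ord0 ord0; pose i3 : 'I_3 := ord_max.
have v11 : g w1 (v i1) *+ 2 = 1 := vE i1 i1.
have v22 : g w2 (v i2) *+ 2 = 1 := vE i2 i2.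
have v33 : g w3 (v i3) *+ 2 = 1 := vE i3 i3.
have z2 (a : K) : a *+ 2 = 0 -> a = 0 by move=> /eqP; rewrite mulrn_eq0 => /eqP.
have v32 : g w3 (v i2) = 0 := z2 _ (vE i3 i2).
have v31 : g w3 (v i1) = 0 := z2 _ (vE i3 i1).
have v21 : g w2 (v i1) = 0 := z2 _ (vE i2 i1).
have [||I3 d3] := @null_vector_img_dim fullv w3 (v i3) g33 v33; do ?by move=> *; apply: memvf.
rewrite capfv in I3 d3.
have [s|s|I2 d2] := @null_vector_img_dim (lker (c w3)) w2 (v i2) g22 v22.
- by apply: lker_gamma_stable; rewrite gC.
- by apply: lker_gamma_stable.
have [||I1 d1] := @null_vector_img_dim (lker (c w3) :&: lker (c w2)) w1 (v i1) g11 v11.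
- move=> s; rewrite !memv_cap => /andP[s3 s2].
  by rewrite !lker_gamma_stable // gC.
- move=> s; rewrite !memv_cap => /andP[s3 s2].
  by rewrite !lker_gamma_stable.
rewrite !limg_comp I3 I2 I1; split=> //.
by rewrite d3 d2 d1 -!muln2 -!mulnA mulnC.
Qed.

Lemma annihilator_isotropic w v s : s != 0 -> c w s = 0 -> c v s = 0 -> g w v = 0.
Proof.
move=> s0 ws vs; have := clifford_relation w v s.
rewrite ws vs !linear0 addr0 => /esym/eqP; rewrite scaler_eq0 (negbTE s0) orbF.
by rewrite mulrn_eq0 => /eqP.
Qed.

(** * Pairings for which vectors act skew-symmetrically *)

Section Pairing.
Variable B : {symmetric S}.
Hypothesis B_nondegenerate : forall s, (forall t, B s t = 0) -> s = 0.
Hypothesis gamma_skew : forall w s t, B (c w s) t = - B s (c w t).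

Let BC s t : B s t = B t s.
Proof. by rewrite hermC expr0 mul1r. Qed.

(* The vectors gamma w s span a totally isotropic subspace, so their span has *)
(* at most half the dimension of S.                                           *)
Lemma annihilator_dim s : B s s = 0 -> exists2 U : {vspace W},
  (forall w, w \in U -> c w s = 0) & ((\dim {:W}).*2 <= \dim {:S} + (\dim U).*2)%N.
Proof.
move=> Bs.
have L_lin : linear (fun w => c w s).
  by move=> k w v; rewrite !linearP add_lfunE scale_lfunE.
pose L : {linear W -> S} := HB.pack (fun w => c w s)
  (GRing.isLinear.Build K W S _ _ L_lin).
exists (lker (linfun L)) => [w|]; first by rewrite memv_ker lfunE => /eqP.
rewrite -{1}(limg_ker_dim (linfun L) fullv) capfv doubleD addnC leq_add2r.
apply: (isotropic_subspace_dim B_nondegenerate) => _ _ /memv_imgP[w _ ->] /memv_imgP[v _ ->].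
rewrite !lfunE /= gamma_skew; apply/eqP; rewrite oppr_eq0; apply/eqP.
(* The sum is a multiple of [B s s]; the difference vanishes because [B (c w s) (c v s)] is
   symmetric in [w] and [v]. *)
have e1 : B s (c w (c v s)) + B s (c v (c w s)) = 0.
  by rewrite -linearDr clifford_relation linearZr_LR /= Bs mulr0.
have e2 : B s (c w (c v s)) - B s (c v (c w s)) = 0.
  apply/eqP; rewrite subr_eq0; apply/eqP/oppr_inj; rewrite -!gamma_skew.
  exact: BC.
by have [] := @addr_subr_eq0 K K^o _ _ e1 e2.
Qed.

(** Moving three skew maps across [B] costs a sign and reverses their order; restoring the order
    swaps three anticommuting pairs, which costs the same sign again. *)
Lemma gamma_triple_symmetric w1 w2 w3 s t :
  g w1 w2 = 0 -> g w1 w3 = 0 -> g w2 w3 = 0 ->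
  B ((c w1 \o (c w2 \o c w3))%VF s) t = B s ((c w1 \o (c w2 \o c w3))%VF t).
Proof.
move=> g12 g13 g23; rewrite !comp_lfunE !gamma_skew !opprK.
rewrite [in RHS](gamma_anti _ g12) (gamma_anti _ g13) !linearN opprK.
by rewrite /= (gamma_anti _ g23) linearN.
Qed.

Hypothesis S_dim : \dim {:S} = 8%N.
Hypothesis g_nondegenerate : forall w, (forall v, g w v = 0) -> w = 0.

Lemma null_triple_spinor w1 w2 w3 : free [:: w1; w2; w3] ->
  g w1 w1 = 0 -> g w2 w2 = 0 -> g w3 w3 = 0 ->
  g w1 w2 = 0 -> g w1 w3 = 0 -> g w2 w3 = 0 ->
  exists2 s, s != 0 & [/\ c w1 s = 0, c w2 s = 0 & c w3 s = 0].
Proof.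
move=> fw g11 g22 g33 g12 g13 g23.
have [-> Sd] := null_triple_img g_nondegenerate fw g11 g22 g33 g12 g13 g23.
set U := (_ :&: _)%VS in Sd; exists (vpick U).
  by rewrite vpick0 -dimv_eq0; apply: contra_eqN Sd => /eqP ->; rewrite S_dim.
by have := memv_pick U; rewrite !memv_cap !memv_ker => /andP[/andP[/eqP-> /eqP->] /eqP->].
Qed.

(** Killing [s] forces the metric conditions on the vectors. By [null_triple_img] the image of their
    product is then a line, and it contains [s]. *)
Lemma null_triple_square w1 w2 w3 s : free [:: w1; w2; w3] ->
  s != 0 -> c w1 s = 0 -> c w2 s = 0 -> c w3 s = 0 ->
  exists2 k, k != 0 &
    gamma (wedge (ext_vec w1) (wedge (ext_vec w2) (ext_vec w3))) = k *: spinor_tensor B s.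
Proof.
move=> fw s0 s1 s2 s3.
have gs := annihilator_isotropic s0.
have [g11 g22 g33] := And3 (gs _ _ s1 s1) (gs _ _ s2 s2) (gs _ _ s3 s3).
have [g12 g13 g23] := And3 (gs _ _ s1 s2) (gs _ _ s1 s3) (gs _ _ s2 s3).
have [Ti Sd] := null_triple_img g_nondegenerate fw g11 g22 g33 g12 g13 g23.
rewrite gamma_wedge3 //; apply: symmetric_rank_one => //.
  by move=> u v; apply: gamma_triple_symmetric.
apply/esym/eqP; rewrite eqEdim -memvE Ti !memv_cap !memv_ker s1 s2 s3 eqxx /=.
by rewrite -Ti dim_vline s0 -(leq_pmul2l (isT : (0 < 8)%N)) -Sd S_dim.
Qed.

End Pairing.

(** * Injectivity of [gamma] on forms of degree at most 3 *)

Variable nu : exterior W.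
Hypothesis nu_top : nu \in ext_deg W n.
Hypothesis gamma_nu : gamma nu != 0.

(* Wedging a nonzero homogeneous element of the kernel up to top degree would *)
(* put the volume form in the kernel.                                         *)
Lemma gamma_homogeneous_inj k x : x \in ext_deg W k -> gamma x = 0 -> x = 0.
Proof.
have [m] := ubnP (n - k); elim: m k x => // m IHm k x; rewrite ltnS => nkm xk gx.
have [kn|nk|kn] := ltngtP k n.
- apply: (wedge_eq0 kn xk) => w; apply: (IHm k.+1); first 1 last.
  + exact: wedge_ext_deg.
  + exact: gamma_ker_wedge xk gx.
  + by rewrite subnS prednK // subn_gt0.
- apply/ffunP => I; rewrite ffunE; move/ext_degP: xk; apply.
  rewrite neq_ltn (leq_ltn_trans _ nk) //.
  by rewrite (leq_trans (max_card _)) ?card_ord.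
- apply/eqP; apply: contraNT gamma_nu => x0; rewrite kn in xk.
  by have [a ->] := ext_deg_top xk nu_top x0; rewrite linearZ /= gx scaler0.
Qed.

(** The contraction of [x] vanishes, so [gamma_ker_parity] puts the homogeneous form [w] wedge [y]
    in the kernel for every [w]. *)
Lemma gamma_deg03_inj x y : (3 < n)%N -> x \in ext_deg W 0 -> y \in ext_deg W 3 ->
  gamma (x + y) = 0 -> x = 0 /\ y = 0.
Proof.
move=> n3 x0 y3 gxy.
have y0 : y = 0.
  apply: (wedge_eq0 n3 y3) => w; apply: gamma_homogeneous_inj (wedge_ext_deg w y3) _.
  have [||+ _] := gamma_ker_parity w _ _ gxy.
  + by rewrite (grade_ext_deg x0) scale1r.
  + by rewrite (grade_ext_deg y3) -signr_odd expr1 scaleN1r.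
  by rewrite (interior_ext_deg0 _ x0) addr0.
by split=> //; apply: (gamma_homogeneous_inj x0); rewrite -[x]addr0 -y0.
Qed.

(** Wedging [y] and contracting [x] with [w] gives degrees 3 and 0, the case already settled. *)
Lemma gamma_deg12_inj x y : (3 < n)%N -> x \in ext_deg W 1 -> y \in ext_deg W 2 ->
  gamma (x + y) = 0 -> x = 0 /\ y = 0.
Proof.
move=> n3 x1 y2; rewrite addrC => gyx.
have y0 : y = 0.
  apply: (wedge_eq0 (ltnW n3) y2) => w.
  have [||_] := gamma_ker_parity w _ _ gyx.
  + by rewrite (grade_ext_deg y2) -signr_odd scale1r.
  + by rewrite (grade_ext_deg x1) expr1 scaleN1r.
  rewrite addrC => /gamma_deg03_inj[] //.
    exact: interior_ext_deg.
  exact: wedge_ext_deg.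
by split=> //; apply: (gamma_homogeneous_inj x1); rewrite -[x]add0r -y0.
Qed.

Lemma clifford_adjoint_deg k x : x \in ext_deg W k ->
  grade_involution (reversion x) = (-1) ^+ (k + 'C(k, 2)) *: x.
Proof.
move=> /ext_degP xk; apply/ffunP => I; rewrite !ffunE /GRing.scale /= exprD mulrA.
by have [->|/xk ->] := eqVneq #|I| k; rewrite ?mulr0.
Qed.

Lemma clifford_adjointD x y : grade_involution (reversion (x + y)) =
  grade_involution (reversion x) + grade_involution (reversion y).
Proof. by apply/ffunP => I; rewrite !ffunE !mulrDr. Qed.

Hypothesis gamma_ker_adjoint : forall x,
  gamma x = 0 -> gamma (grade_involution (reversion x)) = 0.

(* The adjoint fixes degrees 0 and 3 and negates degrees 1 and 2.             *)
Lemma gamma_lt4_inj x : (3 < n)%N -> x \in ext_lt W 4 -> gamma x = 0 -> x = 0.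
Proof.
move=> n3 /memv_sumP[z zk ->].
rewrite !big_ord_recl big_ord0 addr0.
move: (zk ord0 isT) (zk (lift ord0 ord0) isT) (zk (lift ord0 (lift ord0 ord0)) isT)
  (zk (lift ord0 (lift ord0 (lift ord0 ord0))) isT).
move: (z _) (z _) (z _) (z _) => z3 z2 z1 z0 /= d0 d1 d2 d3 gz.
have := gamma_ker_adjoint gz; rewrite !clifford_adjointD.
rewrite (clifford_adjoint_deg d0) (clifford_adjoint_deg d1).
rewrite (clifford_adjoint_deg d2) (clifford_adjoint_deg d3) /=.
rewrite -![_ ^+ (_ + _)]signr_odd /= expr0 expr1 !scale1r !scaleN1r => gz'.
have : gamma (z0 + z3) = 0 /\ gamma (z1 + z2) = 0.
  apply: addr_subr_eq0.
    rewrite -linearD -[RHS]gz; congr (gamma _).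
    by rewrite -addrA; congr (_ + _); rewrite addrC -addrA.
  rewrite -linearB -[RHS]gz'; congr (gamma _).
  by rewrite opprD -addrA; congr (_ + _); rewrite addrC -addrA.
case=> /(gamma_deg03_inj n3 d0 d3)[-> ->] /(gamma_deg12_inj n3 d1 d2)[-> ->].
by rewrite !addr0.
Qed.

End CliffordModule.

(** * The paired module in signature (4, 3) *)

Lemma dim_dual (K : fieldType) (V : vectType K) : \dim {:dual V} = \dim {:V}.
Proof. by rewrite !dimvf [LHS]muln1. Qed.

(** * The metric on the dual space *)

Section DualPairing.
Variables (K : fieldType) (V : vectType K) (h : {symmetric V}).

Lemma signature_nondegenerate p q : has_signature h p q ->
  forall u, (forall v, h u v = 0) -> u = 0.
Proof.
case=> e [be he] u hu; rewrite (coord_basis be (memvf u)) big1 // => i _.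
have := hu (tnth e i); rewrite {1}(coord_basis be (memvf u)) linear_sumlz.
rewrite (bigD1 i) //= big1 ?addr0 => [|j ji]; last first.
  by rewrite linearZl_LR /= -tnth_nth he (negbTE ji) mulr0n mulr0.
rewrite linearZl_LR /= -tnth_nth he eqxx mulr1n => /eqP.
rewrite mulf_eq0 orbC; case: ifP => _; rewrite ?oppr_eq0 oner_eq0 /= => /eqP ->.
all: by rewrite scale0r.
Qed.

(** The dual metric in the curried form that [cl] takes; [dual_formE] identifies it with
    [dual_form]. *)
Definition dual_pairing (t : dual V) : 'Hom(dual V, K^o) :=
  linfun (fun s : dual V => s (sharp h t) : K^o).

Lemma dual_pairingE t s : dual_pairing t s = s (sharp h t).
Proof.
have lin : linear (fun s : dual V => s (sharp h t) : K^o).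
  by move=> k x y; rewrite add_lfunE scale_lfunE.
pose F : {linear dual V -> K^o} := HB.pack (fun s : dual V => s (sharp h t) : K^o)
  (GRing.isLinear.Build K (dual V) K^o _ _ lin).
by rewrite -[dual_pairing t]/(linfun F) lfunE.
Qed.

Hypothesis h_nondegenerate : forall u, (forall v, h u v = 0) -> u = 0.

Lemma flatE u v : flat h u v = h u v.
Proof.
have lin x : linear (h x : V -> K^o) by move=> k y z; exact: linearPr.
pose L x : {linear V -> K^o} :=
  HB.pack (h x : V -> K^o) (GRing.isLinear.Build K V K^o _ _ (lin x)).
have L_lin : linear (fun x => linfun (L x) : dual V).
  by move=> k x y; apply/lfunP=> z; rewrite add_lfunE scale_lfunE !lfunE /= linearPl.
pose F : {linear V -> dual V} := HB.pack (fun x => linfun (L x) : dual V)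
  (GRing.isLinear.Build K V (dual V) _ _ L_lin).
by rewrite -[flat h]/(linfun F) lfunE /= lfunE.
Qed.

Lemma flat_inj : lker (flat h) = 0%VS.
Proof.
apply/eqP; rewrite -subv0; apply/subvP => u; rewrite memv_ker memv0 => /eqP fu.
by apply/eqP/h_nondegenerate => v; rewrite -flatE fu zero_lfunE.
Qed.

Lemma sharpK t : flat h (sharp h t) = t.
Proof.
rewrite /sharp limg_lfunVK //; suff -> : limg (flat h) = fullv by rewrite memvf.
apply/eqP; rewrite eqEdim subvf /= limg_dim_eq ?flat_inj ?capv0 //.
by rewrite !dimvf [X in (X <= _)%N]muln1.
Qed.

Lemma dual_formE t s : dual_form h t s = dual_pairing t s.
Proof.
by rewrite dual_pairingE -{2}(sharpK s) flatE /dual_form hermC expr0 mul1r.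
Qed.

Lemma dual_pairingC t s : dual_pairing t s = dual_pairing s t.
Proof. by rewrite -!dual_formE /dual_form hermC expr0 mul1r. Qed.

Lemma dual_pairing_nondegenerate t : (forall s, dual_pairing t s = 0) -> t = 0.
Proof.
move=> t0; suff st : sharp h t = 0 by rewrite -(sharpK t) st linear0.
apply: h_nondegenerate => v.
by rewrite hermC expr0 mul1r -flatE -dual_pairingE t0.
Qed.

End DualPairing.

Section PairedModule.
Variables (K : realFieldType) (V S : vectType K) (h : {symmetric V}).
Variables (dia : {bilinear exterior (dual V) -> exterior (dual V) -> exterior (dual V)}).
Variables (nu : exterior (dual V)) (l : K).
Variables (gamma : 'Hom(exterior (dual V), 'End(S))) (B : {symmetric S}).
Implicit Types (x : exterior (dual V)) (t : dual V) (s : S).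

Hypothesis dia_geometric : is_geometric_product h dia.
Hypothesis module : irreducible_paired_module dia nu l gamma B.

Lemma paired_module_cl t x :
  gamma (cl (dual_pairing h) t x) = (gamma (ext_vec t) \o gamma x)%VF.
Proof.
rewrite -(module_mul module) (proj2 dia_geometric); congr (gamma (_ + _)).
apply/ffunP => I; rewrite !interiorE; apply: eq_bigr => i _.
by rewrite dual_pairingE.
Qed.

Lemma paired_module_skew t s1 s2 :
  B (gamma (ext_vec t) s1) s2 = - B s1 (gamma (ext_vec t) s2).
Proof.
rewrite (pairing_adjoint module) (clifford_adjoint_deg (ext_vec_deg t)).
by rewrite expr1 scaleN1r linearN opp_lfunE linearNr.
Qed.

Lemma paired_module_ker_adjoint x :
  gamma x = 0 -> gamma (grade_involution (reversion x)) = 0.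
Proof.
move=> gx; apply/lfunP => s; rewrite zero_lfunE.
apply: (pairing_nondegenerate module) => s'; rewrite hermC expr0 mul1r.
by rewrite /= -(pairing_adjoint module) gx zero_lfunE linear0l.
Qed.

Hypothesis l2 : l * l = 1.

(** As [gamma nu] is [l] times the identity and [l * l = 1], both summands of the projection act
    alike. *)
Lemma gamma_half_proj x : gamma (half_proj dia nu l x) = gamma x.
Proof.
rewrite /half_proj linearZ linearD linearZ /= (module_mul module).
rewrite (module_volume module) -comp_lfunZl comp_lfun1l scalerA l2 scale1r.
by rewrite -mulr2n -scaler_nat scalerA mulVf ?pnatr_eq0 // scale1r.
Qed.

Lemma Psi_ltE (x : subvs_of (ext_lt (dual V) 4)) :
  Psi_lt dia nu l gamma x = gamma (vsval x).
Proof.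
have lin : linear (fun x : subvs_of (ext_lt (dual V) 4) =>
    gamma (half_proj dia nu l (vsval x))).
  by move=> k y z; rewrite !gamma_half_proj !linearP.
pose F : {linear _ -> 'End(S)} := HB.pack
  (fun x : subvs_of (ext_lt (dual V) 4) => gamma (half_proj dia nu l (vsval x)))
  (GRing.isLinear.Build K (subvs_of (ext_lt (dual V) 4)) 'End(S) _ _ lin).
by rewrite -[Psi_lt _ _ _ _]/(linfun F) lfunE /= gamma_half_proj.
Qed.

Hypothesis h_nondegenerate : forall u, (forall v, h u v = 0) -> u = 0.
Hypothesis nu_top : nu \in ext_deg (dual V) (\dim {:dual V}).
Hypothesis V_dim : (3 < \dim {:V})%N.

(** Injectivity of [Psi_lt] suffices here, because the preimage [x] is given. *)
Lemma spinor_square_unique x mu s : x \in ext_lt (dual V) 4 ->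
  gamma x = mu *: spinor_tensor B s -> x = spinor_square dia nu l gamma B mu s.
Proof.
move=> x4 gx; rewrite /spinor_square -gx -[x]/(vsval (Subvs x4)) -Psi_ltE.
rewrite lker0_lfunK // -subv0; apply/subvP => y; rewrite memv_ker memv0 Psi_ltE.
move=> /eqP gy; rewrite -(inj_eq val_inj) /=; apply/eqP.
apply: (gamma_lt4_inj _ (module_unit module) paired_module_cl nu_top) => //.
- exact: dual_pairingC.
- rewrite (module_volume module) scaler_eq0 negb_or; apply/andP; split.
    by apply: contraNneq (oner_neq0 K) => l0; rewrite -l2 l0 mul0r.
  apply/eqP => id0; have := module_dim module.
  rewrite (_ : fullv = 0%VS) ?dimv0 //; apply/eqP; rewrite -subv0.
  apply/subvP => s' _; have /lfunP/(_ s') := id0.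
  by rewrite id_lfunE zero_lfunE memv0 => ->.
- exact: paired_module_ker_adjoint.
- by rewrite dim_dual.
- exact: subvsP.
Qed.

End PairedModule.

Theorem theorem1p12 (R : realType) (V : vectType R) (h : {symmetric V})
    (o : (4 + 3).-tuple V)
    (dia : {bilinear exterior (dual V) -> exterior (dual V) -> exterior (dual V)})
    (nu : exterior (dual V))
    (S : vectType R) (l : R) (gamma : 'Hom(exterior (dual V), 'End(S)))
    (B : {symmetric S}) (alpha : exterior (dual V)) :
  \dim {:V} = 7%N ->
  has_signature h 4 3 ->
  basis_of {:V} o ->
  is_geometric_product h dia ->
  is_volume_form h o nu ->
  l = -1 \/ l = 1 ->
  irreducible_paired_module dia nu l gamma B ->
  alpha \in ext_lt (dual V) 4 ->
  (exists eps : S, B eps eps = 0 /\ is_square_of dia nu l gamma B alpha eps) <->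
  (exists vartheta theta eta : dual V,
    [/\ alpha = wedge (wedge (ext_vec vartheta) (ext_vec theta)) (ext_vec eta),
        isotropic h vartheta /\ isotropic h theta /\ isotropic h eta
      & dual_form h vartheta theta = 0 /\ dual_form h vartheta eta = 0 /\
        dual_form h theta eta = 0]).
Proof.
move=> dV sig _ geo vol l1 mod a4.
have l2 : l * l = 1 by case: l1 => ->; rewrite ?mulrNN mulr1.
have hnd := signature_nondegenerate sig.
have nu_top : nu \in ext_deg (dual V) (\dim {:dual V}).
  case: vol => e [_ _ ->]; rewrite [X in ext_deg _ X]dim_dual dV.
  have := big_wedge_deg (index_enum 'I_(4 + 3)) (coframe e).
  by rewrite [X in size X]unlock -enumT size_enum_ord.
have V4 : (3 < \dim {:V})%N by rewrite dV.
have gC := dual_pairingC hnd; have gnd := dual_pairing_nondegenerate hnd.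
have gE t s : dual_form h t s = dual_pairing h t s := dual_formE hnd t s.
have unique x mu s := @spinor_square_unique _ _ _ _ _ _ _ _ _ geo mod l2 hnd nu_top V4 x mu s.
have g1 := module_unit mod; have gcl := paired_module_cl geo mod.
have Bnd := pairing_nondegenerate mod; have skew := paired_module_skew mod.
have Sd := module_dim mod.
have square0 mu : 0 = spinor_square dia nu l gamma B mu 0.
  apply: unique; rewrite ?mem0v // linear0; apply/esym/lfunP => t.
  by rewrite scale_lfunE spinor_tensorE !scaler0 zero_lfunE.
split=> [[eps [eps_iso [mu [mu1 ->]]]]|[w1 [w2 [w3 [-> [h11 [h22 h33]] [h12 [h13 h23]]]]]]].
  have [->|eps0] := eqVneq eps 0.
    by exists 0, 0, 0; rewrite /isotropic !gE !linear0 -square0.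
  have [U U0 Ud] := annihilator_dim gC g1 gcl Bnd skew eps_iso.
  (* The bound reads 14 <= 8 + 2 * [\dim U]. *)
  have {}Ud : (3 <= \dim U)%N.
    by rewrite -leq_double -(leq_add2l 8) -Sd (leq_trans _ Ud) // dim_dual dV Sd.
  (* As a plain sequence, the basis can be destructed to reach its first three vectors. *)
  have [X UX] : exists X : seq (dual V), vbasis U = X :> seq _ by exists (vbasis U).
  have fX := basis_free (vbasisP U); have sX := size_tuple (vbasis U).
  have mX w : w \in (vbasis U : seq _) -> gamma (ext_vec w) eps = 0.
    by move=> /vbasis_mem; apply: U0.
  move: fX sX mX; rewrite UX => fX sX mX; move: Ud; rewrite -sX.
  case: X fX mX {UX sX} => [|w1 [|w2 [|w3 X]]] //= fX mX _.
  have fw : free [:: w1; w2; w3] by exact: (@catl_free _ _ X [:: w1; w2; w3]).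
  have [s1 s2 s3] : [/\ gamma (ext_vec w1) eps = 0, gamma (ext_vec w2) eps = 0
      & gamma (ext_vec w3) eps = 0] by split; apply: mX; rewrite !inE eqxx ?orbT.
  have [k k0 gw] := null_triple_square gC g1 gcl Bnd skew Sd gnd fw eps0 s1 s2 s3.
  have gs := annihilator_isotropic gC g1 gcl eps0.
  (* The factor [mu / k] turns the multiple [k] into [mu]. *)
  have s1' : gamma (ext_vec ((mu / k) *: w1)) eps = 0.
    by rewrite !linearZ /= scale_lfunE s1 scaler0.
  exists ((mu / k) *: w1), w2, w3; rewrite /isotropic !gE; split; last 2 first.
  - by rewrite !gs.
  - by rewrite !gs.
  rewrite -wedgeA wedge_vecZl; apply/esym/unique.
    apply/memvZ/(@ext_deg_sub_lt _ _ 3) => //.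
    by do 2!apply: wedge_ext_deg; apply: ext_vec_deg.
  by rewrite linearZ /= gw scalerA divfK.
(* A zero wedge is the square of the zero spinor; a nonzero one forces independence. *)
have [->|a0] := eqVneq (wedge (wedge (ext_vec w1) (ext_vec w2)) (ext_vec w3)) 0.
  by exists 0; split; [rewrite linear0l | exists 1; split; [right|]].
rewrite -wedgeA in a0 *; have two : (2%:R : R) != 0 by rewrite pnatr_eq0.
have fw := wedge3_free two a0.
rewrite /isotropic !gE in h11 h22 h33 h12 h13 h23.
have [s s0 [s1 s2 s3]] := null_triple_spinor gC g1 gcl Sd gnd fw h11 h22 h33 h12 h13 h23.
have [k k0 gw] := null_triple_square gC g1 gcl Bnd skew Sd gnd fw s0 s1 s2 s3.
exists (Num.sqrt `|k| *: s); split.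
  rewrite linearZl_LR linearZr_LR /=; suff -> : B s s = 0 by rewrite !mulr0.
  (* The product sends [s] to 0, as [w3] kills it, and also to [k * B s s] times [s]. *)
  have := gamma_wedge3 gcl h12 h13 h23; rewrite gw => /lfunP/(_ s).
  rewrite !comp_lfunE s3 !linear0 scale_lfunE spinor_tensorE => /eqP.
  by rewrite !scaler_eq0 (negbTE k0) (negbTE s0) orbF => /eqP.
(* The square of the rescaling factor is [|k|], so the sign completes it to [k]. *)
exists (Num.sg k); split.
  by case: sgrP k0; rewrite ?eqxx //; [right|left].
apply: unique.
  apply: (@ext_deg_sub_lt _ _ 3) => //.
  by do 2!apply: wedge_ext_deg; apply: ext_vec_deg.
by rewrite gw spinor_tensorZ scalerA sqr_sqrtr // -numEsg.
Qed.
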